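(* Let $A\in\mathrm{End}(\mathbb C^n\otimes\mathbb C^n)$ be an idempotent and $S=1-A$. Let $\mathfrak U_k$ be an associative unital algebra over $\mathbb C$, and let $\rho\colon\mathfrak U_k\to\mathrm{End}((\mathbb C^n)^{\otimes k})$ and $\varepsilon\colon\mathfrak U_k\to\mathbb C$ be algebra homomorphisms. Let $s_{(k)}\in\mathfrak U_k$ be a normalised left and right invariant element: $$us_{(k)}=s_{(k)}u=\varepsilon(u)s_{(k)}\quad\text{for all }u\in\mathfrak U_k,\qquad \varepsilon(s_{(k)})=1.$$ (1) Suppose there exist elements $u_1,\dots,u_{k-1}\in\mathfrak U_k$ such that $\rho(u_a)=A^{(a,a+1)}$ and $\varepsilon(u_a)=0$. If $$(X^*\otimes\cdots\otimes X^* )\rho(u)=\varepsilon(u)(X^*\otimes\cdots\otimes X^* ),\qquad \rho(u)(X\otimes\cdots\otimes X)=\varepsilon(u)(X\otimes\cdots\otimes X)$$ for all $u\in\mathfrak U_k$, then $S_{(k)}=\rho(s_{(k)})$ is the $k$-th $S$-operator for $A$. (2) Suppose there exist elements $u_1,\dots,u_{k-1}\in\mathfrak U_k$ such that $\rho(u_a)=S^{(a,a+1)}$ and $\varepsilon(u_a)=0$. If $$(\Psi\otimes\cdots\otimes\Psi)\rho(u)=\varepsilon(u)(\Psi\otimes\cdots\otimes\Psi),\qquad \rho(u)(\Psi^*\otimes\cdots\otimes\Psi^* )=\varepsilon(u)(\Psi^*\otimes\cdots\otimes\Psi^* )$$ for all $u\in\mathfrak U_k$, then $A_{(k)}=\rho(s_{(k)})$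 is the $k$-th $A$-operator for $A$.
   Context: Entries of $A$: $A(e_i\otimes e_j)=\sum_{k,l}A^{kl}_{ij}e_k\otimes e_l$; $(e_i)$, $(e^i)$ are the standard dual bases of columns $\mathbb C^n$ and rows $(\mathbb C^n)^*$. $T^{(a,a+1)}\in\mathrm{End}((\mathbb C^n)^{\otimes k})$ acts as $T$ in the tensor factors $a,a+1$. Four unital associative $\mathbb C$-algebras are associated to $A$: $\mathfrak X_A(\mathbb C)$, generators $x^1,\dots,x^n$, relations $\sum_{i,j}A^{kl}_{ij}x^ix^j=0$; $\mathfrak X^*_A(\mathbb C)$, generators $x_1,\dots,x_n$, relations $\sum_{i,j}x_ix_jA^{ij}_{kl}=0$; $\Xi_A(\mathbb C)$, generators $\psi_1,\dots,\psi_n$, relations $\psi_i\psi_j=\sum_{k,l}A^{kl}_{ij}\psi_k\psi_l$; $\Xi^*_A(\mathbb C)$, generators $\psi^1,\dots,\psi^n$, relations $\psi^i\psi^j=\sum_{k,l}A^{ij}_{kl}\psi^k\psi^l$. Put $X=\sum x^ie_i$, $X^*=\sum x_ie^i$, $\Psi=\sum\psi_ie^i$, $\Psi^*=\sum\psi^ie_i$ and (with $k$ factors) $X\otimes\cdots\otimes X=\sum x^{i_1}\cdots x^{i_k}e_{i_1}\otimes\cdots\otimes e_{i_k}$, etc. Operators act on columns from the left and on rows from the right. $S_{(k)}\in\mathrm{End}((\mathbb C^n)^{\otimes k})$ is the $k$-th $S$-operator for $A$ if $A^{(a,a+1)}S_{(k)}=S_{(k)}A^{(a,a+1)}=0$ for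 $1\le a\le k-1$, $(X^*\otimes\cdots\otimes X^* )S_{(k)}=X^*\otimes\cdots\otimes X^*$, $S_{(k)}(X\otimes\cdots\otimes X)=X\otimes\cdots\otimes X$. $A_{(k)}$ is the $k$-th $A$-operator for $A$ if $S^{(a,a+1)}A_{(k)}=A_{(k)}S^{(a,a+1)}=0$ for $1\le a\le k-1$, $(\Psi\otimes\cdots\otimes\Psi)A_{(k)}=\Psi\otimes\cdots\otimes\Psi$, $A_{(k)}(\Psi^*\otimes\cdots\otimes\Psi^* )=\Psi^*\otimes\cdots\otimes\Psi^*$. *)

(* Defs.v *)
(* The complex numbers are R[i], for R a realType. *)
From HB Require Import structures.
From mathcomp Require Import all_boot all_order all_algebra.
From mathcomp Require Import generic_quotient ring_quotient.
From mathcomp Require Import boolp reals complex.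
From mathcomp Require Import finmap monalg.

Set Implicit Arguments.
Unset Strict Implicit.
Unset Printing Implicit Defensive.

Import GRing.Theory.
Local Open Scope ring_scope.
Local Open Scope quotient_scope.

Section Presentation.
Variables (F : comNzRingType) (I : choiceType).

Local Notation freealg := {malg F[{fmonom I}]}.

Definition freevar (i : I) : freealg := << fmu i >>.

Inductive tsideal (J : Type) (r : J -> freealg) : freealg -> Prop :=
| tsideal_rel j : tsideal r (r j)
| tsideal0 : tsideal r 0
| tsidealB p q : tsideal r p -> tsideal r q -> tsideal r (p - q)
| tsidealMl p q : tsideal r q -> tsideal r (p * q)
| tsidealMr p q : tsideal r p -> tsideal r (p * q).

Definition constcoef (p : freealg) : F := mcoeff mone p.
HB.instance Definition _ := GRing.RMorphism.copy constcoef (mcoeff mone).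

Lemma constcoef_var i : constcoef (freevar i) = 0.
Proof.
rewrite /constcoef /freevar mcoeffU; case: eqP => // /(congr1 (@fdeg I)).
by rewrite fdegU fdeg1.
Qed.

Lemma freealg_scaleAr a (p q : freealg) : a *: (p * q) = p * (a *: q).
Proof.
apply/malgP => m; rewrite mcoeffZ mcoeffMl mulr_sumr.
rewrite (mcoeffMlw _ (fsubset_refl _) (msuppZ_le a q)).
apply: eq_bigr => k1 _; rewrite mulr_sumr; apply: eq_bigr => k2 _.
by rewrite mcoeffZ mulrnAr mulrCA.
Qed.

Section Quotient.
Variables (J : Type) (r : J -> freealg).

Definition in_tsideal : {pred freealg} := fun p => `[< tsideal r p >].

Fact tsideal_zmod : zmod_closed in_tsideal.
Proof.
split; first exact/asboolP/tsideal0.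
by move=> p q /asboolP rp /asboolP rq; apply/asboolP/tsidealB.
Qed.
HB.instance Definition _ := GRing.isZmodClosed.Build freealg in_tsideal tsideal_zmod.

(* Relations without constant term, so that the quotient is a nonzero ring,
   as required by [algType]. *)
Hypothesis r0 : forall j, constcoef (r j) = 0.

Lemma tsideal_constcoef p : tsideal r p -> constcoef p = 0.
Proof.
elim=> {p} // [|p q _ Hp _ Hq|p q _ Hq|p q _ Hp]; rewrite ?raddf0 //.
- by rewrite raddfB /= Hp Hq subr0.
- by rewrite rmorphM /= Hq mulr0.
- by rewrite rmorphM /= Hp mul0r.
Qed.

Definition presalg (_ : forall j, constcoef (r j) = 0) : Type := {ideal_quot in_tsideal}.

End Quotient.
End Presentation.

HB.instance Definition _ (F : comNzRingType) (I : choiceType) (J : Type)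
    (r : J -> {malg F[{fmonom I}]}) (r0 : forall j, constcoef (r j) = 0) :=
  GRing.Zmodule.on (presalg r0).

(* Locked, lest unification unfold the quotient operations. *)
HB.lock Definition pipres (F : comNzRingType) (I : choiceType) (J : Type)
    (r : J -> {malg F[{fmonom I}]}) (r0 : forall j, constcoef (r j) = 0)
    (p : {malg F[{fmonom I}]}) : presalg r0 :=
  \pi_({ideal_quot in_tsideal r}) p.

HB.lock Definition presmul (F : comNzRingType) (I : choiceType) (J : Type)
    (r : J -> {malg F[{fmonom I}]}) (r0 : forall j, constcoef (r j) = 0)
    (x y : presalg r0) : presalg r0 :=
  pipres r0 (repr (x : {ideal_quot in_tsideal r}) *
             repr (y : {ideal_quot in_tsideal r})).

HB.lock Definition presscale (F : comNzRingType) (I : choiceType) (J : Type)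
    (r : J -> {malg F[{fmonom I}]}) (r0 : forall j, constcoef (r j) = 0)
    (a : F) (x : presalg r0) : presalg r0 :=
  pipres r0 (a *: repr (x : {ideal_quot in_tsideal r})).

Section PresentedAlgebra.
Variables (F : comNzRingType) (I : choiceType) (J : Type).
Local Notation freealg := {malg F[{fmonom I}]}.
Variables (r : J -> freealg) (r0 : forall j, constcoef (r j) = 0).

Local Notation Q := (presalg r0).
Local Notation pi := (pipres r0).
Local Notation presmul := (@presmul F I J r r0).
Local Notation presscale := (@presscale F I J r r0).
Local Notation in_tsideal := (in_tsideal r).
Let rp (x : Q) : freealg := repr (x : {ideal_quot in_tsideal}).

Let piE p : pi p = \pi_({ideal_quot in_tsideal}) p.
Proof. by rewrite pipres.unlock. Qed.

Lemma pipresP p q : reflect (pi p = pi q) (p - q \in in_tsideal).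
Proof. by rewrite !piE Quotient.idealrBE; exact: eqP. Qed.

Let rpK x : pi (rp x) = x. Proof. rewrite piE; exact: reprK. Qed.

Lemma pipres_surj (x : Q) : exists p, x = pi p.
Proof. by exists (rp x); rewrite rpK. Qed.

Lemma pipresB : {morph pi : p q / p - q}.
Proof. by move=> p q; rewrite !piE raddfB. Qed.

Lemma pipresD : {morph pi : p q / p + q}.
Proof. by move=> p q; rewrite !piE raddfD. Qed.

Lemma pipresM p q : presmul (pi p) (pi q) = pi (p * q).
Proof.
rewrite presmul.unlock; apply/pipresP/asboolP.
have -> : rp (pi p) * rp (pi q) - p * q
  = rp (pi p) * (rp (pi q) - q) - (p - rp (pi p)) * q.
  by rewrite mulrBr mulrBl opprB addrA addrNK.
apply: tsidealB; [apply: tsidealMl|apply: tsidealMr];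
  by apply/asboolP/pipresP; rewrite rpK.
Qed.

Lemma pipresZ a p : presscale a (pi p) = pi (a *: p).
Proof.
rewrite presscale.unlock; apply/pipresP/asboolP; rewrite -scalerBr -mul_malgC; apply: tsidealMl.
by apply/asboolP/pipresP; rewrite rpK.
Qed.

Fact presmulA : associative presmul.
Proof.
move=> x y z; have [p ->] := pipres_surj x; have [q ->] := pipres_surj y.
by have [s ->] := pipres_surj z; rewrite !pipresM mulrA.
Qed.
Fact presmul1x : left_id (pi 1) presmul.
Proof. by move=> x; have [p ->] := pipres_surj x; rewrite pipresM mul1r. Qed.
Fact presmulx1 : right_id (pi 1) presmul.
Proof. by move=> x; have [p ->] := pipres_surj x; rewrite pipresM mulr1. Qed.
Fact presmulDl : left_distributive presmul +%R.
Proof.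
move=> x y z; have [p ->] := pipres_surj x; have [q ->] := pipres_surj y.
by have [s ->] := pipres_surj z; rewrite -pipresD !pipresM -pipresD mulrDl.
Qed.
Fact presmulDr : right_distributive presmul +%R.
Proof.
move=> x y z; have [p ->] := pipres_surj x; have [q ->] := pipres_surj y.
by have [s ->] := pipres_surj z; rewrite -pipresD !pipresM -pipresD mulrDr.
Qed.
Fact presone_neq0 : pi 1 != 0.
Proof.
apply/eqP => pi10; have /asboolP/(tsideal_constcoef r0)/eqP : 1 - 0 \in in_tsideal.
  by apply/pipresP; rewrite pi10 piE raddf0.
by rewrite subr0 rmorph1 oner_eq0.
Qed.
HB.instance Definition _ := GRing.Zmodule_isNzRing.Build Q
  presmulA presmul1x presmulx1 presmulDl presmulDr presone_neq0.

Fact presscaleA a b x : presscale a (presscale b x) = presscale (a * b) x.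
Proof. by have [p ->] := pipres_surj x; rewrite !pipresZ scalerA. Qed.
Fact presscale1 : left_id 1 presscale.
Proof. by move=> x; have [p ->] := pipres_surj x; rewrite pipresZ scale1r. Qed.
Fact presscaleDr : right_distributive presscale +%R.
Proof.
move=> a x y; have [p ->] := pipres_surj x; have [q ->] := pipres_surj y.
by rewrite -pipresD !pipresZ -pipresD scalerDr.
Qed.
Fact presscaleDl x : {morph presscale^~ x : a b / a + b}.
Proof. by move=> a b; have [p ->] := pipres_surj x; rewrite !pipresZ -pipresD scalerDl. Qed.
HB.instance Definition _ := GRing.Zmodule_isLmodule.Build F Q
  presscaleA presscale1 presscaleDr presscaleDl.

Fact presscaleAl a (x y : Q) : a *: (x * y) = (a *: x) * y.
Proof.
have [p ->] := pipres_surj x; have [q ->] := pipres_surj y.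
by rewrite /GRing.scale /GRing.mul /= pipresM !pipresZ pipresM scalerAl.
Qed.
HB.instance Definition _ := GRing.Lmodule_isLalgebra.Build F Q presscaleAl.

Fact presscaleAr a (x y : Q) : a *: (x * y) = x * (a *: y).
Proof.
have [p ->] := pipres_surj x; have [q ->] := pipres_surj y.
rewrite /GRing.scale /GRing.mul /= pipresM !pipresZ pipresM; by rewrite freealg_scaleAr.
Qed.
HB.instance Definition _ := GRing.Lalgebra_isAlgebra.Build F Q presscaleAr.

Fact pipres_zmod : zmod_morphism pi. Proof. exact: pipresB. Qed.
Fact pipres_monoid : monoid_morphism pi.
Proof. by split=> // p q; rewrite -pipresM. Qed.
Fact pipres_scalable : scalable pi.
Proof. by move=> a p; rewrite -pipresZ. Qed.
HB.instance Definition _ := GRing.isZmodMorphism.Build _ Q pi pipres_zmod.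
HB.instance Definition _ := GRing.isMonoidMorphism.Build _ Q pi pipres_monoid.
HB.instance Definition _ := GRing.isScalable.Build F _ Q *:%R pi pipres_scalable.

Lemma pipres_rel j : pi (r j) = 0.
Proof.
rewrite -[RHS](raddf0 pi); apply/pipresP/asboolP.
by rewrite subr0; apply: tsideal_rel.
Qed.

Definition presgen (i : I) : Q := pi (freevar F i).

End PresentedAlgebra.

(* A tensor power (F^n)^{(x) k} has basis e_{i_1} (x) ... (x) e_{i_k} indexed by
   the tuples of 'I_n; its endomorphisms are the matrices below, acting on
   columns from the left and on rows from the right, so the row index of an
   entry is the upper multi-index and the column index the lower one. *)
Definition tdim (n k : nat) : nat := #|{: k.-tuple 'I_n}|.

Notation "''T[' F ]_ ( n , k )" := 'M[F]_(tdim n k)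
  (at level 8, format "''T[' F ]_ ( n ,  k )") : type_scope.

(* [tens2 A k l i j] is A^{kl}_{ij}. *)
Definition tens2 (F : comNzRingType) (n : nat) (A : 'T[F]_(n, 2))
    (k l i j : 'I_n) : F :=
  A (enum_rank [tuple k; l]) (enum_rank [tuple i; j]).

Section TensorPower.
Variables (F : comNzRingType) (n : nat).

Definition midx k (p : 'I_(tdim n k)) : k.-tuple 'I_n := enum_val p.

(* 0-based positions of the tensor factors a and a + 1. *)
Definition fstpos k (a : 'I_k.-1) : 'I_k := widen_ord (leq_pred k) a.
Definition sndpos k (a : 'I_k.-1) : 'I_k :=
  Ordinal (etrans (esym (ltn_predRL a k)) (ltn_ord a)).

(* T^{(a,a+1)} *)
Definition leg (T : 'T[F]_(n, 2)) k (a : 'I_k.-1) : 'T[F]_(n, k) :=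
  \matrix_(p, q)
    let I := midx p in let J := midx q in
    tens2 T (tnth I (fstpos a)) (tnth I (sndpos a))
            (tnth J (fstpos a)) (tnth J (sndpos a))
    * \prod_(b : 'I_k | (b != fstpos a) && (b != sndpos a))
        (tnth I b == tnth J b)%:R.

End TensorPower.

(* Y (x) ... (x) Y for the column sum_i y_i e_i, resp. the row sum_i y_i e^i,
   with entries in the noncommutative algebra B. *)
Definition colpow (F : comNzRingType) (n : nat) (B : algType F)
    (y : 'I_n -> B) (k : nat) : 'cV[B]_(tdim n k) :=
  \col_p \prod_(i <- midx p) y i.
Definition rowpow (F : comNzRingType) (n : nat) (B : algType F)
    (y : 'I_n -> B) (k : nat) : 'rV[B]_(tdim n k) :=
  \row_p \prod_(i <- midx p) y i.

Definition opmx (F : comNzRingType) (n : nat) (B : algType F) (k : nat)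
    (T : 'T[F]_(n, k)) : 'M[B]_(tdim n k) :=
  map_mx (in_alg B) T.

(* The defining relations, indexed by the pair m of free indices; locked, lest
   unification compare distinct relations by unfolding. *)
HB.lock Definition rel_X (F : comNzRingType) (n : nat) (A : 'T[F]_(n, 2))
    (m : 'I_n * 'I_n) : {malg F[{fmonom 'I_n}]} :=
  \sum_i \sum_j tens2 A m.1 m.2 i j *: (freevar F i * freevar F j).
HB.lock Definition rel_Xdual (F : comNzRingType) (n : nat) (A : 'T[F]_(n, 2))
    (m : 'I_n * 'I_n) : {malg F[{fmonom 'I_n}]} :=
  \sum_i \sum_j tens2 A i j m.1 m.2 *: (freevar F i * freevar F j).
HB.lock Definition rel_Xi (F : comNzRingType) (n : nat) (A : 'T[F]_(n, 2))
    (m : 'I_n * 'I_n) : {malg F[{fmonom 'I_n}]} :=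
  freevar F m.1 * freevar F m.2
  - \sum_k \sum_l tens2 A k l m.1 m.2 *: (freevar F k * freevar F l).
HB.lock Definition rel_Xidual (F : comNzRingType) (n : nat) (A : 'T[F]_(n, 2))
    (m : 'I_n * 'I_n) : {malg F[{fmonom 'I_n}]} :=
  freevar F m.1 * freevar F m.2
  - \sum_k \sum_l tens2 A m.1 m.2 k l *: (freevar F k * freevar F l).

Section Operators.
Variables (F : comNzRingType) (n : nat) (A : 'T[F]_(n, 2)).

Fact constcoef_quad (c : 'I_n -> 'I_n -> F) :
  constcoef (\sum_i \sum_j c i j *: (freevar F i * freevar F j)) = 0.
Proof.
rewrite raddf_sum big1 // => i _; rewrite raddf_sum big1 // => j _.
by rewrite /= [LHS]mcoeffZ -/(constcoef _) rmorphM /= constcoef_var mul0r mulr0.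
Qed.
Fact rel_X0 m : constcoef (rel_X A m) = 0.
Proof. rewrite rel_X.unlock; exact: constcoef_quad. Qed.
Fact rel_Xdual0 m : constcoef (rel_Xdual A m) = 0.
Proof. rewrite rel_Xdual.unlock; exact: constcoef_quad. Qed.
Fact rel_Xi0 m : constcoef (rel_Xi A m) = 0.
Proof.
rewrite rel_Xi.unlock.
by rewrite raddfB /= constcoef_quad rmorphM /= constcoef_var mul0r subr0.
Qed.
Fact rel_Xidual0 m : constcoef (rel_Xidual A m) = 0.
Proof.
rewrite rel_Xidual.unlock.
by rewrite raddfB /= constcoef_quad rmorphM /= constcoef_var mul0r subr0.
Qed.

(* X_A, X^*_A, Xi_A and Xi^*_A, with their generators x^i, x_i, psi_i, psi^i. *)
Definition algX : algType F := presalg rel_X0.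
Definition algXdual : algType F := presalg rel_Xdual0.
Definition algXi : algType F := presalg rel_Xi0.
Definition algXidual : algType F := presalg rel_Xidual0.

Definition x_up (i : 'I_n) : algX := presgen rel_X0 i.
Definition x_lo (i : 'I_n) : algXdual := presgen rel_Xdual0 i.
Definition psi_lo (i : 'I_n) : algXi := presgen rel_Xi0 i.
Definition psi_up (i : 'I_n) : algXidual := presgen rel_Xidual0 i.

Fact pipres_quad (r : 'I_n * 'I_n -> {malg F[{fmonom 'I_n}]})
    (r0 : forall m, constcoef (r m) = 0) (c : 'I_n -> 'I_n -> F) :
  pipres r0 (\sum_i \sum_j c i j *: (freevar F i * freevar F j))
  = \sum_i \sum_j c i j *: (presgen r0 i * presgen r0 j).
Proof.
rewrite raddf_sum; apply: eq_bigr => i _; rewrite raddf_sum.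
by apply: eq_bigr => j _; rewrite [LHS]linearZ_LR [in LHS]rmorphM.
Qed.

Lemma x_up_rel k l :
  \sum_i \sum_j tens2 A k l i j *: (x_up i * x_up j) = 0.
Proof.
rewrite -(pipres_quad rel_X0) -[RHS](pipres_rel rel_X0 (k, l)).
by congr (pipres _ _); rewrite rel_X.unlock.
Qed.

Lemma x_lo_rel k l :
  \sum_i \sum_j tens2 A i j k l *: (x_lo i * x_lo j) = 0.
Proof.
rewrite -(pipres_quad rel_Xdual0) -[RHS](pipres_rel rel_Xdual0 (k, l)).
by congr (pipres _ _); rewrite rel_Xdual.unlock.
Qed.

Lemma psi_lo_rel i j :
  psi_lo i * psi_lo j = \sum_k \sum_l tens2 A k l i j *: (psi_lo k * psi_lo l).
Proof.
apply/eqP; rewrite -subr_eq0; apply/eqP.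
rewrite -(pipres_quad rel_Xi0) -[in LHS]rmorphM -[LHS]pipresB.
rewrite -[RHS](pipres_rel rel_Xi0 (i, j)).
by congr (pipres _ _); rewrite rel_Xi.unlock.
Qed.

Lemma psi_up_rel i j :
  psi_up i * psi_up j = \sum_k \sum_l tens2 A i j k l *: (psi_up k * psi_up l).
Proof.
apply/eqP; rewrite -subr_eq0; apply/eqP.
rewrite -(pipres_quad rel_Xidual0) -[in LHS]rmorphM -[LHS]pipresB.
rewrite -[RHS](pipres_rel rel_Xidual0 (i, j)).
by congr (pipres _ _); rewrite rel_Xidual.unlock.
Qed.

Definition is_Soperator k (S : 'T[F]_(n, k)) : Prop :=
  [/\ forall a : 'I_k.-1, leg A a *m S = 0 /\ S *m leg A a = 0,
      rowpow x_lo k *m opmx _ S = rowpow x_lo k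
    & opmx _ S *m colpow x_up k = colpow x_up k].

Definition is_Aoperator k (T : 'T[F]_(n, k)) : Prop :=
  [/\ forall a : 'I_k.-1,
        leg (1%:M - A) a *m T = 0 /\ T *m leg (1%:M - A) a = 0,
      rowpow psi_lo k *m opmx _ T = rowpow psi_lo k
    & opmx _ T *m colpow psi_up k = colpow psi_up k].

End Operators.

(* Main.v *)
Require Import Defs.
From HB Require Import structures.
From mathcomp Require Import all_boot all_order all_algebra.
From mathcomp Require Import reals complex.
Import GRing.Theory.
Local Open Scope ring_scope.

(** Both conditions on the operator are images under [rho] of identities in [U]. Invariance makes
    [u * s] and [s * u] multiples of [s] by the scalar [eps u], so they vanish for each [u] lifting
    a leg operator, and [rho] carries this to annihilation ([invariant_image_annihilates]). The
    fixed-vector conditions are the equivariance hypotheses at [u = s], where normalisation makes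
    the scalar 1. *)

Lemma invariant_image_annihilates (F : comNzRingType) (m : nat) (U : algType F)
  (rho : {rmorphism U -> 'M[F]_m}) (eps : U -> F) (s u : U) :
  u * s = eps u *: s -> s * u = eps u *: s -> eps u = 0 ->
  rho u *m rho s = 0 /\ rho s *m rho u = 0.
Proof.
(* For square matrices [*m] is convertible to the ring product, the form in which multiplicativity
   of [rho] applies. *)
move=> us su eu0; rewrite -[rho u *m _]/(rho u * rho s) -[rho s *m _]/(rho s * rho u).
by rewrite -!rmorphM us su eu0 scale0r rmorph0.
Qed.

Theorem theorem5p26 (R : realType) (n k : nat) (A : 'T[R[i]]_(n, 2))
  (A_idem : A *m A = A)
  (U : algType R[i])
  (rho : {rmorphism U -> 'T[R[i]]_(n, k)}) (rhoZ : scalable rho)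
  (eps : {lrmorphism U -> R[i] | *%R})
  (s : U)
  (s_inv : forall u : U, u * s = eps u *: s /\ s * u = eps u *: s)
  (eps_s : eps s = 1) :
  ((exists u : 'I_k.-1 -> U,
      forall a : 'I_k.-1, rho (u a) = leg A a /\ eps (u a) = 0) ->
   (forall u : U,
      rowpow (x_lo A) k *m opmx _ (rho u) = (eps u)%:A *: rowpow (x_lo A) k) ->
   (forall u : U,
      opmx _ (rho u) *m colpow (x_up A) k = (eps u)%:A *: colpow (x_up A) k) ->
   is_Soperator A (rho s))
  /\
  ((exists u : 'I_k.-1 -> U,
      forall a : 'I_k.-1, rho (u a) = leg (1%:M - A) a /\ eps (u a) = 0) ->
   (forall u : U,
      rowpow (psi_lo A) k *m opmx _ (rho u) =
        (eps u)%:A *: rowpow (psi_lo A) k) ->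
   (forall u : U,
      opmx _ (rho u) *m colpow (psi_up A) k =
        (eps u)%:A *: colpow (psi_up A) k) ->
   is_Aoperator A (rho s)).
Proof.
split=> -[u Hu] Hrow Hcol.
- split=> [a||].
  (* Replace the leg operator by [rho (u a)], with [eps (u a) = 0]. *)
  + have [<- eu0] := Hu a; have [us su] := s_inv (u a).
    exact: invariant_image_annihilates us su eu0.
  (* [scale1r] acts twice: [1%:A] becomes the unit of the algebra, which then scales the row
     trivially. *)
  + by rewrite Hrow eps_s !scale1r.
  + by rewrite Hcol eps_s !scale1r.
(* The same argument, with the [u a] now lifting the legs of [1%:M - A]. *)
- split=> [a||].
  + have [<- eu0] := Hu a; have [us su] := s_inv (u a).
    exact: invariant_image_annihilates us su eu0.
  + by rewrite Hrow eps_s !scale1r.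
  + by rewrite Hcol eps_s !scale1r.
Qed.
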